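(* For any numerical semigroup $H$ one has $$\mathcal{C}_H \subseteq \operatorname{tr}(H) \subseteq H .$$ If $H$ is not symmetric, then $\mathcal{C}_H \subseteq \operatorname{tr}(H) \subseteq M$, where $M = H\setminus\{0\}$.
   Context: A numerical semigroup $H$ is a submonoid of $(\mathbb{N},+)$ (with $0\in\mathbb{N}$) such that $\mathbb{N}\setminus H$ is finite; it is assumed that its minimal number of generators is greater than $1$ (i.e. $H\neq\mathbb{N}$). $M=H\setminus\{0\}$. The elements of $G(H)=\mathbb{N}\setminus H$ are the gaps of $H$, and the Frobenius number $F(H)$ is the largest integer not in $H$. The set of pseudo-Frobenius numbers is $PF(H)=\{f\in G(H): f+M\subseteq H\}$. $H$ is symmetric if for all $x\in\mathbb{Z}$ either $x\in H$ or $F(H)-x\in H$. The canonical ideal of $H$ is $\Omega_H=\{-f+h : f\in PF(H),\ h\in H\}\subset\mathbb{Z}$, and the anti-canonical ideal is $\Omega_H^{-1}=\{x\in\mathbb{Z}: x+\Omega_H\subseteq H\}$. The trace of $H$ is $\operatorname{tr}(H)=\Omega_H+\Omega_H^{-1}=\{u+v:u\in\Omega_H, v\in\Omega_H^{-1}\}$. The conductor ideal is $\mathcal{C}_H=\{h\in \mathbb{N}: h>F(H)\}$, which is an ideal of $H$. *)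

(* Defs.v *)
From mathcomp Require Export all_boot all_order all_algebra.
From mathcomp Require Export boolp classical_sets cardinality.

Set Implicit Arguments.
Unset Strict Implicit.
Unset Printing Implicit Defensive.

Import Order.TTheory GRing.Theory Num.Theory.

Local Open Scope classical_set_scope.
Local Open Scope ring_scope.

(* The last field is the standing assumption that H needs more than one
   generator. *)
Record numerical_semigroup (H : set nat) : Prop := NumericalSemigroup {
  numsg0 : H 0%N ;
  numsgD : forall a b : nat, H a -> H b -> H (a + b)%N ;
  numsg_cofinite : finite_set (~` H) ;
  numsg_proper : H <> setT }.

(* A set of naturals, seen as a set of integers. *)
Definition toZ (A : set nat) : set int := [set n%:Z | n in A].

Definition gaps (H : set nat) : set nat := ~` H.

Definition maxideal (H : set nat) : set nat := H `\ 0%N.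

(* The default value 0 of [xget] is irrelevant: see [frobeniusP]. *)
Definition frobenius (H : set nat) : int :=
  xget 0 (~` toZ H `&` ubound (~` toZ H)).

Definition pseudo_frobenius (H : set nat) : set nat :=
  [set f | gaps H f /\ forall m, maxideal H m -> H (f + m)%N].

Definition symmetric_semigroup (H : set nat) : Prop :=
  forall x : int, toZ H x \/ toZ H (frobenius H - x).

Definition canonical_ideal (H : set nat) : set int :=
  [set - f%:Z + h%:Z | f in pseudo_frobenius H & h in H].

Definition anticanonical_ideal (H : set nat) : set int :=
  [set x | forall u, canonical_ideal H u -> toZ H (x + u)].

Definition semigroup_trace (H : set nat) : set int :=
  [set u + v | u in canonical_ideal H & v in anticanonical_ideal H].

Definition conductor (H : set nat) : set nat :=
  [set h | frobenius H < h%:Z].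

Lemma frobeniusP (H : set nat) : numerical_semigroup H ->
  ~ toZ H (frobenius H) /\ forall x, ~ toZ H x -> x <= frobenius H.
Proof.
case=> _ _ Hfin Hproper.
suff [F HF] : exists F, (~` toZ H `&` ubound (~` toZ H)) F.
  by have [] := xgetPex (0 : int) (ex_intro _ F HF).
have [g Hg] : exists g, ~ H g.
  by apply: contrapT => nex; apply: Hproper; rewrite -subTset => x _;
     apply: contrapT => nx; apply: nex; exists x.
have /finite_seqP[s Hs] := Hfin.
have sE n : ~ H n <-> n \in s by have /= -> : (~` H) n = [set` s] n by rewrite Hs.
pose m := (\max_(i <- s) i)%N.
have sm : m \in s.
  have : s != [::] by apply: contraPneq (proj1 (sE g) Hg) => ->.
  rewrite /m; elim: s {Hs sE m Hg} => // a [|b s] IH _.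
    by rewrite big_seq1 inE.
  rewrite big_cons inE /maxn; case: ifP => _; last by rewrite eqxx.
  by rewrite IH ?orbT.
exists m%:Z; split=> [[k Hk [km]]|x Hx].
  by move/sE: sm; apply; rewrite -km.
case: x Hx => [n Hn|n _] //.
rewrite lez_nat; apply: (@leq_bigmax_seq _ s xpredT id n) => //; apply/sE => nH.
by apply: Hn; exists n.
Qed.

(* Main.v *)
Require Import Defs.
From mathcomp Require Import zify.
Local Open Scope classical_set_scope.

Set Implicit Arguments.
Unset Strict Implicit.
Unset Printing Implicit Defensive.

(** Write F for the Frobenius number and Omega for the canonical ideal. If
    [h > F], then [h = - F + (h + F)] lies in the trace, since every element of
    Omega is at least [- F]. If 0 is in the trace, then 0 = u + v with [- u]
    outside H, so [v <= F]; but [v - F] lies in H, so [v = F] and [F + Omega] is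
    contained in H. As [- x] lies in Omega for every x outside H, this says that
    H is symmetric. *)

Lemma toZD (H : set nat) (x y : int) : numerical_semigroup H ->
  toZ H x -> toZ H y -> toZ H (x + y)%R.
Proof.
move=> hH [a Ha <-] [b Hb <-]; exists (a + b)%N; first exact: (numsgD hH).
by rewrite PoszD.
Qed.

Lemma toZ_nat (H : set nat) (n : nat) : toZ H (Posz n) -> H n.
Proof. by case=> k Hk [<-]. Qed.

Lemma frobenius_lt_toZ (H : set nat) (x : int) : numerical_semigroup H ->
  (frobenius H < x)%R -> toZ H x.
Proof.
by move=> hH Fx; apply: contrapT => /(proj2 (frobeniusP hH)); lia.
Qed.

Lemma frobenius_ge0 (H : set nat) : numerical_semigroup H ->
  (0 <= frobenius H)%R.
Proof.
move=> hH; have [g nHg] : exists g, ~ H g.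
  apply: contrapT => nex; apply: (numsg_proper hH); rewrite -subTset => k _.
  by apply: contrapT => nk; apply: nex; exists k.
have : (Posz g <= frobenius H)%R by apply: (proj2 (frobeniusP hH)) => /toZ_nat.
lia.
Qed.

(** Pseudo-Frobenius numbers are naturals by definition, while the ascent in
    [pseudo_frobenius_above] may start at any integer; this recognises its endpoint. *)
Lemma pseudo_frobenius_int (H : set nat) (x : int) : numerical_semigroup H ->
    ~ toZ H x -> (forall m, maxideal H m -> toZ H (x + Posz m)%R) ->
  exists2 f, pseudo_frobenius H f & x = Posz f.
Proof.
move=> hH nHx Hxm; have [FnH _] := frobeniusP hH.
case: x nHx Hxm => [f nHf Hfm|n nHn Hnm].
  exists f => //; split=> [Hf|m Mm]; first by apply: nHf; exists f.
  by apply: toZ_nat; rewrite PoszD; apply: Hfm.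
(* A negative x is impossible: m = F - x lies in M and x + m = F. *)
exfalso; apply: FnH; have F_ge0 := frobenius_ge0 hH.
have [m mE] : exists m, Posz m = (frobenius H - Negz n)%R.
  by exists `|frobenius H - Negz n|%N; lia.
rewrite (_ : frobenius H = Negz n + Posz m)%R; last lia.
apply: Hnm; split; last by move=> /= m0; lia.
by apply: toZ_nat; apply: frobenius_lt_toZ => //; lia.
Qed.

(** Climb from x: as long as some nonzero m in H keeps x + m outside H, pass to x + m. The climb
    ends at a pseudo-Frobenius number, and its steps add up to an element of H. *)
Lemma pseudo_frobenius_above (H : set nat) (x : int) :
    numerical_semigroup H -> ~ toZ H x ->
  exists2 f, pseudo_frobenius H f & toZ H (Posz f - x)%R.
Proof.
move=> hH; have [_ Fmax] := frobeniusP hH.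
(* The distance F - x is nonnegative outside H and drops by m > 0 at each step. *)
have [n] := ubnP `|frobenius H - x|%N.
elim: n x => // n IH x le_n nHx.
have [Hxm|] := pselect (forall m, maxideal H m -> toZ H (x + Posz m)%R).
  have [f PFf ->] := pseudo_frobenius_int hH nHx Hxm.
  by exists f => //; rewrite GRing.subrr; exists 0%N => //; exact: (numsg0 hH).
move=> /existsNP[m /not_implyP[[Hm /eqP m0] nHxm]].
have [||f PFf Hf] := IH (x + Posz m)%R => //.
  by have := Fmax _ nHx; have := Fmax _ nHxm; lia.
exists f => //.
rewrite (_ : Posz f - x = Posz f - (x + Posz m) + Posz m)%R; last lia.
by apply: toZD => //; exists m.
Qed.

(** If x = - f + h with - x in H, then f = - x + h would lie in H. Conversely, the climb from - x
    reaches some f with f + x in H, and x = - f + (f + x). *)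
Lemma canonical_idealE (H : set nat) (x : int) : numerical_semigroup H ->
  canonical_ideal H x <-> ~ toZ H (- x)%R.
Proof.
move=> hH; split=> [[f [nHf _] [h Hh <-]] Hx|nHx].
  apply: nHf; apply: toZ_nat.
  rewrite (_ : Posz f = - (- Posz f + Posz h) + Posz h)%R; last lia.
  by apply: toZD => //; exists h.
have [f PFf [h Hh hE]] := pseudo_frobenius_above hH nHx.
by exists f => //; exists h => //; lia.
Qed.

Lemma conductor_sub_trace (H : set nat) : numerical_semigroup H ->
  toZ (conductor H) `<=` semigroup_trace H.
Proof.
move=> hH _ [h /= Fh <-]; have [FnH Fmax] := frobeniusP hH.
exists (- frobenius H)%R; first by apply/canonical_idealE; rewrite ?GRing.opprK.
exists (Posz h + frobenius H)%R; last lia.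
move=> u /(canonical_idealE _ hH)/Fmax u_ge.
by apply: frobenius_lt_toZ => //; move: Fh; rewrite /conductor /=; lia.
Qed.

Lemma trace_sub (H : set nat) : semigroup_trace H `<=` toZ H.
Proof. by move=> _ [u Ku [v Kv <-]]; rewrite GRing.addrC; apply: Kv. Qed.

Lemma trace0_symmetric (H : set nat) : numerical_semigroup H ->
  semigroup_trace H 0%R -> symmetric_semigroup H.
Proof.
move=> hH [u Ku [v Kv uv0]]; have [FnH Fmax] := frobeniusP hH.
have v_le : (v <= frobenius H)%R.
  by apply: Fmax; rewrite (_ : v = - u)%R; [exact/canonical_idealE|lia].
(* As F is outside H, - F lies in Omega; so v - F is a natural number k, which gives F <= v. *)
have [|k _ kE] := Kv (- frobenius H)%R.
  by apply/canonical_idealE; rewrite ?GRing.opprK.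
have vF : v = frobenius H by lia.
move=> x; have [|nHx] := pselect (toZ H x); [by left|right].
by rewrite -vF; apply/Kv/canonical_idealE; rewrite ?GRing.opprK.
Qed.

Theorem proposition1p1 (H : set nat) (hH : numerical_semigroup H) :
  (toZ (conductor H) `<=` semigroup_trace H /\
   semigroup_trace H `<=` toZ H) /\
  (~ symmetric_semigroup H ->
   toZ (conductor H) `<=` semigroup_trace H /\
   semigroup_trace H `<=` toZ (maxideal H)).
Proof.
have conductorP := conductor_sub_trace hH.
split; first by split=> //; exact: trace_sub.
move=> nsym; split=> // x tr_x; have [n Hn nx] := trace_sub tr_x.
exists n => //; split=> //= n0; apply/nsym/trace0_symmetric => //.
by move: tr_x; rewrite -nx n0.
Qed.
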